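(* Let $d=\sqrt{p}$ be a positive integer and $n\ge1$. Let $\mathbf{X}$ be an $n$-element subset of $\{-1,1\}^{d}$ chosen uniformly at random, listed in uniformly random order as $x^{(1)},\dots,x^{(n)}$. Let $\eta^{(1)},\dots,\eta^{(n)}$ be i.i.d. $\mathcal{N}(0,\sigma_\eta^2 I_d)$, independent of $\mathbf{X}$, and release $\mathbf{X}_\eta=(x^{(1)}+\eta^{(1)},\dots,x^{(n)}+\eta^{(n)})$. Let $\gamma\in(0,1)$ satisfy $\gamma\le1-\frac{4}{n\sqrt{p}}$, and suppose $n\le2^{\sqrt{p}/4}$ and $$\sigma_\eta^2\ge\frac{4}{(1-\gamma)\log2}.$$ Then every adversary fails to recover the original data up to permutation with probability at least $\gamma$: $$\inf_{\mathcal{A}}\mathbb{P}_{\mathbf{X},\eta}\big[\mathcal{A}(\mathbf{X}_\eta)\neq\mathbf{X}\big]\ge\gamma,$$ where the infimum is over all maps $\mathcal{A}$ from $(\mathbb{R}^{d})^n$ to $n$-element subsets of $\{-1,1\}^d$.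
   Context: This is the data model of MLE for a zero-mean Ising model on $\sqrt{p}$ spins, whose sufficient statistic is $x x^{T}$; the perturbed sufficient statistic published from $\mathbf{X}_\eta$ is a function of $\mathbf{X}_\eta$. Logarithms are natural. *)

(* Defs.v *)
From HB Require Import structures.
From mathcomp Require Import all_boot all_order all_algebra.
From mathcomp Require Import all_classical all_reals all_analysis.
Set Implicit Arguments. Unset Strict Implicit. Unset Printing Implicit Defensive.
Import Order.TTheory GRing.Theory Num.Theory.
Local Open Scope classical_set_scope.
Local Open Scope ring_scope.

(* A point of the hypercube {-1,1}^d is encoded as a d.-tuple of booleans;
   the boolean b stands for the real coordinate [pm1 b] (true |-> 1, false |-> -1). *)
Definition pm1 {R : realType} (b : bool) : R := if b then 1 else -1.

Definition mutually_independent {R : realType} {d} {Omega : measurableType d}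
  (P : probability Omega R) {I : finType} (E : I -> set (set Omega)) : Prop :=
  forall (J : {set I}) (A : I -> set Omega),
    (forall i, i \in J -> E i (A i)) ->
    P (\bigcap_(i in [set` J]) A i) = (\prod_(i in J) P (A i))%E.

Definition sigma_fin {Omega : Type} {T : finType} (X : Omega -> T) : set (set Omega) :=
  [set A | exists S : set T, A = X @^-1` S].
Definition sigma_real {R : realType} {Omega : Type} (Y : Omega -> R) : set (set Omega) :=
  [set A | exists B : set R, measurable B /\ A = Y @^-1` B].

Definition noisy_release {R : realType} {Omega : Type} (n dim : nat)
  (X : Omega -> n.-tuple (dim.-tuple bool)) (eta : 'I_n -> 'I_dim -> Omega -> R)
  (w : Omega) : n.-tuple (dim.-tuple R) :=
  [tuple [tuple pm1 (tnth (tnth (X w) i) j) + eta i j w | j < dim] | i < n].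

(* Main.v *)
Require Import Defs.
From HB Require Import structures.
From mathcomp Require Import all_boot all_order all_algebra.
From mathcomp Require Import all_classical all_reals all_analysis.
From mathcomp Require Import measurable_realfun ring lra.
Set Implicit Arguments. Unset Strict Implicit. Unset Printing Implicit Defensive.
Import Order.TTheory GRing.Theory Num.Theory.
Local Open Scope classical_set_scope.
Local Open Scope ring_scope.

(* Write [N] for the number of duplicate-free tuples. If [t] is released, the
   density [L] of the shifted noise vector with respect to the unshifted one
   satisfies [E L^2 = exp (n d / s2)], so [L <= L^2 / (2 K) + K / 2] bounds the
   probability of decoding [t] by [exp (n d / s2) / (2 K) + K / 2 * q_t], where
   [q_t] is the probability that the adversary outputs the set of [t] on pure
   noise. Every output set of size [n] has [n!] orderings, hence the [q_t] sum
   to at most [n!], and averaging over [t] bounds the success probability by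
   [exp (n d / s2) / (2 K) + K / 2 * n! / N]. Since [n! / N <= (n / 2^d)^n],
   the choice [K = 2^(n d / 2)] makes this at most
   [2^(- n d / 4) <= 4 / (n d) <= 1 - gamma]. *)

(** * Measures given by a density *)

Section density.
Import HBNNSimple.

(** For an indicator [f] the integral formula is the definition of [nu]; linearity carries it to
    simple functions, and monotone convergence along [nnsfun_approx] to every nonnegative measurable
    [f]. *)
Lemma ge0_density_measure (d : measure_display) (T : measurableType d)
    (R : realType) (m : {measure set T -> \bar R}) (g : T -> R) :
  measurable_fun [set: T] g -> (forall x, 0 <= g x) ->
  exists nu : {measure set T -> \bar R},
    (forall A, measurable A -> nu A = \int[m]_(x in A) (g x)%:E)%E /\
    (forall f : T -> \bar R, measurable_fun [set: T] f ->
       (forall x, 0 <= f x)%E ->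
       \int[nu]_x f x = \int[m]_x (f x * (g x)%:E))%E.
Proof.
move=> mg g0.
have mG : measurable_fun [set: T] (fun x => (g x)%:E) by exact/measurable_EFinP.
have G0 x : (0 <= (g x)%:E)%E by rewrite lee_fin.
pose nu0 (A : set T) : \bar R := (\int[m]_(x in A) (g x)%:E)%E.
have nu00 : nu0 set0 = 0%E by rewrite /nu0 integral_set0.
have nu0_ge0 A : (0 <= nu0 A)%E by exact: integral_ge0.
have nu0_sigma : semi_sigma_additive nu0.
  move=> /= A mA tA mUA; rewrite /nu0 ge0_integral_bigcup//; last first.
    exact: measurable_funTS.
  by apply: is_cvg_ereal_nneg_natsum_cond => n _ _; exact: integral_ge0.
pose nu : {measure set T -> \bar R} :=
  HB.pack nu0 (isMeasure.Build _ _ _ nu0 nu00 nu0_ge0 nu0_sigma).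
exists nu; split => // f mf f0.
pose h := nnsfun_approx measurableT mf.
have -> : (\int[nu]_x f x = limn (fun n => \int[nu]_x (h n x)%:E))%E.
  rewrite -monotone_convergence//.
  - apply: eq_integral => x _; apply/esym/cvg_lim => //.
    exact: cvg_nnsfun_approx.
  - by move=> n; exact/measurable_EFinP.
  - by move=> n x _; rewrite lee_fin.
  - by move=> x _ a b ab; rewrite lee_fin; exact/lefP/nd_nnsfun_approx.
have -> : (\int[m]_x (f x * (g x)%:E) =
    limn (fun n => \int[m]_x ((h n x)%:E * (g x)%:E)))%E.
  rewrite -monotone_convergence//.
  - apply: eq_integral => x _; apply/esym/cvg_lim => //.
    by apply: cvgeZr => //; exact: cvg_nnsfun_approx.
  - by move=> n; apply/emeasurable_funM => //; exact/measurable_EFinP.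
  - by move=> n x _; rewrite mule_ge0 ?lee_fin.
  - move=> x _ a b ab; rewrite lee_wpmul2r ?lee_fin//.
    exact/lefP/nd_nnsfun_approx.
congr (limn _); apply/funext => n.
have mh r : measurable (h n @^-1` [set r]) by [].
(* Split the simple function over its finitely many values, so that only indicators of level sets
   remain. *)
transitivity (\int[nu]_x
   (\sum_(y \in range (h n)) (y * \1_(h n @^-1` [set y]) x)%:E))%E.
  by apply: eq_integral => t _; rewrite /= fimfunE -fsumEFin.
transitivity (\int[m]_x (\sum_(y \in range (h n))
    (y * \1_(h n @^-1` [set y]) x)%:E * (g x)%:E))%E; last first.
  apply: eq_integral => x _.
  rewrite -ge0_mule_fsuml => [|y]; last exact: nnfun_muleindic_ge0.
  by rewrite fsumEFin // -(fimfunE _ x).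
have mind r :
    measurable_fun [set: T] (fun x => (r * \1_(h n @^-1` [set r]) x)%:E).
  by apply/measurable_EFinP/measurable_funM.
rewrite ge0_integral_fsum//; last by move=> ? ? _; exact: nnfun_muleindic_ge0.
rewrite ge0_integral_fsum//; last 2 first.
  - by move=> y; exact: emeasurable_funM (mind y) mG.
  - by move=> k y _; rewrite mule_ge0// nnfun_muleindic_ge0.
apply: eq_fsbigr => r rhn.
under eq_integral do rewrite EFinM.
rewrite integralZl_indic_nnsfun => //.
under [RHS]eq_integral do rewrite EFinM -muleA.
have r0 : 0 <= r by move: rhn; rewrite inE => -[x _ <-].
rewrite ge0_integralZl//; last 2 first.
  - by apply: emeasurable_funM => //; exact/measurable_EFinP.
  - by move=> x _; rewrite mule_ge0// lee_fin.
congr (_ * _)%E.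
rewrite integral_indic// setIT /nu /= /nu0 integral_mkcond.
by apply: eq_integral => x _; rewrite epatch_indic muleC.
Qed.

End density.

(** * Translates of a centred Gaussian *)

Lemma lebesgue_measure_shift (R : realType) (c : R) (A : set R) : measurable A ->
  lebesgue_measure (( +%R c : R -> R) @^-1` A) = lebesgue_measure A.
Proof.
move=> mA.
pose shift_c : measurableTypeR R -> measurableTypeR R := +%R c.
have mc : measurable_fun [set: measurableTypeR R] shift_c.
  exact: measurable_funD.
pose phi : {mfun (measurableTypeR R) >-> (measurableTypeR R)} :=
  HB.pack shift_c (isMeasurableFun.Build _ _ _ _ _ mc).
apply/esym/(@lebesgue_measure_unique _ (pushforward lebesgue_measure phi))
  => //= _ [[a b]] _ <-.
rewrite /pushforward /=.
have -> : phi @^-1` `]a, b] = `](a - c), (b - c)]%classic.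
  by apply/seteqP; split => x /=; rewrite !in_itv /= ltrBlDl lerBrDl.
rewrite !lebesgue_measure_itv/= !lte_fin ltrD2r.
by case: ifP => // _; rewrite -!EFinB opprD addrACA subrr addr0.
Qed.

(* The density of [N(c, s2)] with respect to [N(0, s2)]. *)
Definition gaussian_tilt {R : realType} (s2 c x : R) : R :=
  expR (c * x / s2 - c ^+ 2 / (2 * s2)).

Lemma measurable_gaussian_tilt (R : realType) (s2 c : R) :
  measurable_fun [set: R] (gaussian_tilt s2 c).
Proof.
apply: measurableT_comp => //; apply: measurable_funB => //.
by apply: measurable_funM => //; exact: measurable_funM.
Qed.

Lemma gaussian_tilt_ge0 (R : realType) (s2 c x : R) : 0 <= gaussian_tilt s2 c x.
Proof. exact: expR_ge0. Qed.

(** A squared tilt is again a tilt up to a constant, so second moments of densities reduce to their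
    total mass. *)
Lemma gaussian_tilt_sqr (R : realType) (s2 c x : R) : 0 < s2 ->
  gaussian_tilt s2 c x ^+ 2 = expR (c ^+ 2 / s2) * gaussian_tilt s2 (2 * c) x.
Proof.
move=> s20; rewrite /gaussian_tilt -expRM_natl -expRD; congr expR.
have s2n : s2 != 0 by rewrite gt_eqF.
by field.
Qed.

Lemma normal_pdf_shift (R : realType) (s2 c x : R) : 0 < s2 ->
  normal_pdf 0 (Num.sqrt s2) (x - c) =
  normal_pdf 0 (Num.sqrt s2) x * gaussian_tilt s2 c x.
Proof.
move=> s20; rewrite normal_pdfE ?gt_eqF ?sqrtr_gt0// -mulrA; congr (_ * _).
rewrite /normal_fun /gaussian_tilt -expRD sqr_sqrtr ?ltW//; congr expR.
have s2n : s2 != 0 by rewrite gt_eqF.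
by rewrite -mulr_natl; field.
Qed.

(** One-dimensional Cameron-Martin formula: translation invariance of Lebesgue measure moves the
    shift from the set to the density, where [normal_pdf_shift] splits off the tilt. *)
Lemma normal_prob_shift (R : realType) (s2 c : R) (B : set R) :
  0 < s2 -> measurable B ->
  normal_prob 0 (Num.sqrt s2) ((+%R c : R -> R) @^-1` B) =
  (\int[normal_prob 0 (Num.sqrt s2)]_x (\1_B x * gaussian_tilt s2 c x)%:E)%E.
Proof.
move=> s20 mB; set s := Num.sqrt s2.
have [nu [nuE int_nu]] := @ge0_density_measure _ _ R lebesgue_measure
  (normal_pdf 0 s) (measurable_normal_pdf _ _) (@normal_pdf_ge0 _ _ _).
pose shift_c : measurableTypeR R -> measurableTypeR R := +%R c.
have mc : measurable_fun [set: measurableTypeR R] shift_c.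
  exact: measurable_funD.
have mcB : measurable (shift_c @^-1` B).
  by rewrite -[X in measurable X]setTI; exact: mc.
have -> : (\int[normal_prob 0 s]_x (\1_B x * gaussian_tilt s2 c x)%:E =
   \int[nu]_x (\1_B x * gaussian_tilt s2 c x)%:E)%E.
  by apply: eq_measure_integral => A mA _; rewrite nuE.
rewrite int_nu; last 2 first.
- apply/measurable_EFinP/measurable_funM => //; exact: measurable_gaussian_tilt.
- by move=> x; rewrite lee_fin mulr_ge0 ?gaussian_tilt_ge0.
(* Writing [x] as [c + x - c] makes the integrand a function of [shift_c x], ready for the change of
   variables. *)
transitivity (\int[lebesgue_measure]_(x in shift_c @^-1` B)
    (normal_pdf 0 s (c + x - c))%:E)%E.
  by apply: eq_integral => x _; rewrite addrAC subrr add0r.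
transitivity (\int[lebesgue_measure]_(x in B) (normal_pdf 0 s (x - c))%:E)%E.
  transitivity (\int[pushforward lebesgue_measure shift_c]_(x in B)
      (normal_pdf 0 s (x - c))%:E)%E.
    rewrite ge0_integral_pushforward//.
    - apply: measurable_funTS; apply/measurable_EFinP.
      apply: measurableT_comp; first exact: measurable_normal_pdf.
      exact: measurable_funB.
    - by move=> x _; rewrite lee_fin normal_pdf_ge0.
  apply: eq_measure_integral => A mA _; exact: lebesgue_measure_shift.
rewrite [LHS]integral_mkcond; apply: eq_integral => x _.
rewrite epatch_indic -!EFinM normal_pdf_shift//; congr EFin; ring.
Qed.

(** * Independence and products of expectations *)

Lemma mutually_independent_Some (R : realType) (d : measure_display)
    (Omega : measurableType d) (P : probability Omega R) (I : finType)
    (E : option I -> set (set Omega)) :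
  mutually_independent P E -> mutually_independent P (fun i => E (Some i)).
Proof.
move=> indE J A EA.
pose A' k := if k is Some i then A i else setT.
have := indE (Some @: J)%SET A'.
rewrite big_imset/=; last by move=> i j _ _ [].
have -> : \bigcap_(i in [set` (Some @: J)%SET]) A' i = \bigcap_(i in [set` J]) A i.
  apply/seteqP; split => w Aw i /= iJ.
    by apply: (Aw (Some i)); rewrite /= imset_f.
  by case/imsetP: iJ => j jJ ->; exact: Aw.
by apply=> k /imsetP[j jJ ->]; exact: EA.
Qed.

(** [None] indexes the data and [Some] the noise coordinates: a data event factors out of an
    intersection of coordinate events. *)
Lemma mutually_independent_None (R : realType) (d : measure_display)
    (Omega : measurableType d) (P : probability Omega R) (I : finType)
    (E : option I -> set (set Omega)) (A0 : set Omega) (A : I -> set Omega) :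
  mutually_independent P E -> E None A0 -> (forall i, E (Some i) (A i)) ->
  P (A0 `&` \bigcap_i A i) = (P A0 * \prod_i P (A i))%E.
Proof.
move=> indE EA0 EA.
pose A' k := if k is Some i then A i else A0.
have -> : A0 `&` \bigcap_i A i =
    \bigcap_(i in [set` None |: (Some @: [set: I])%SET]) A' i.
  apply/seteqP; split => [w [A0w Aw] [i|] _//=|w Aw].
    exact: Aw.
  split; first by apply: (Aw None); rewrite /= setU11.
  by move=> i _; apply: (Aw (Some i)); rewrite /= setU1r// imset_f// inE.
rewrite indE; last by case.
rewrite big_setU1/=; last by apply/imsetP => -[].
rewrite big_imset/=; last by move=> i j _ _ [].
by congr (_ * _)%E; apply: eq_bigl => i; rewrite inE.
Qed.

Section integral_prod.
Context (R : realType) (d : measure_display) (Omega : measurableType d).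
Variables (P : probability Omega R) (I : finType) (xi : I -> Omega -> R).
Hypothesis mxi : forall i, measurable_fun [set: Omega] (xi i).
Hypothesis indep : mutually_independent P (fun i => sigma_real (xi i)).

Let measurable_xi_preimage i (B : set R) : measurable B -> measurable (xi i @^-1` B).
Proof. by move=> mB; rewrite -[X in measurable X]setTI; exact: mxi. Qed.

Let integral_prod_indic (B : I -> set R) : (forall i, measurable (B i)) ->
  (\int[P]_w (\prod_i \1_(B i) (xi i w))%:E = \prod_i P (xi i @^-1` B i))%E.
Proof.
move=> mB.
have := indep (J := [set: I]%SET) (A := fun i => xi i @^-1` B i).
have -> : \bigcap_(i in [set` [set: I]%SET]) xi i @^-1` B i = \bigcap_i xi i @^-1` B i.
  by apply/seteqP; split => w Bw i _; apply: Bw; rewrite /= ?inE.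
under eq_bigl do rewrite inE.
move=> <-; last by move=> i _; exists (B i).
have mcap : measurable (\bigcap_i xi i @^-1` B i).
  apply: fin_bigcap_measurable => // i _; exact: measurable_xi_preimage.
rewrite -[X in P X]setIT -integral_indic//; apply: eq_integral => w _; congr EFin.
rewrite [RHS]indicE; case: (asboolP ((\bigcap_i xi i @^-1` B i) w)) => Bw.
  rewrite mem_set// big1// => i _; rewrite indicE mem_set//; exact: Bw.
rewrite memNset//; have [i Bi] : exists i, ~ B i (xi i w).
  by apply/existsNP => Bw'; apply: Bw => i _; exact: Bw'.
by rewrite (bigD1 i)//= indicE memNset// mul0r.
Qed.

(** Induction on the list [s] of coordinates whose factor may fail to be an indicator. For [k] in
    front, weighting [P] by the other factors gives a law of [xi k] that is a constant multiple of
    the original one; this is tested on sets [B], where the [k]-th factor becomes [\1_B] and the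
    induction hypothesis applies. *)
Let integral_prod_seq (s : seq I) (f : I -> R -> R) (r : I -> R) :
  (forall i, i \notin s -> exists2 B, measurable B & f i = \1_B) ->
  (forall i, measurable_fun [set: R] (f i)) -> (forall i x, 0 <= f i x) ->
  (forall i, \int[P]_w (f i (xi i w))%:E = (r i)%:E)%E ->
  (\int[P]_w (\prod_i f i (xi i w))%:E = (\prod_i r i)%:E)%E.
Proof.
elim: s f r => [|k s IH] f r f_ind mf f0 fr.
  have /choice[B BE] : forall i, exists B, measurable B /\ f i = \1_B.
    by move=> i; have [//|B mB fB] := f_ind i; exists B.
  transitivity (\int[P]_w (\prod_i \1_(B i) (xi i w))%:E)%E.
    by apply: eq_integral => w _; congr EFin; apply: eq_bigr => i _; rewrite (BE i).2.
  rewrite integral_prod_indic => [|i]; last exact: (BE i).1.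
  rewrite -prodEFin; apply: eq_bigr => i _; rewrite -fr (BE i).2.
  have mB := measurable_xi_preimage i (BE i).1.
  by rewrite (_ : (fun w => _) = (fun w => (\1_(xi i @^-1` B i) w)%:E))//
    integral_indic// setIT.
pose G w := \prod_(i | i != k) f i (xi i w).
have mG : measurable_fun [set: Omega] G.
  rewrite /G; under eq_fun do rewrite -big_filter.
  by apply: measurable_prod => i _; exact: measurableT_comp.
have G0 w : 0 <= G w by apply: prodr_ge0.
have [nu [nuE int_nu]] := ge0_density_measure P mG G0.
pose c := \prod_(i | i != k) r i.
have r0 i : 0 <= r i by rewrite -lee_fin -fr; apply: integral_ge0 => w _; rewrite lee_fin.
have c0 : 0 <= c by apply: prodr_ge0.
have mfxi i : measurable_fun [set: Omega] (fun w => (f i (xi i w))%:E).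
  by apply/measurable_EFinP; exact: measurableT_comp.
have mfk : measurable_fun [set: R] (fun x => (f k x)%:E) by exact/measurable_EFinP.
transitivity (\int[nu]_w (f k (xi k w))%:E)%E.
  rewrite int_nu//; last by move=> w; rewrite lee_fin.
  by apply: eq_integral => w _; rewrite (bigD1 k)//= EFinM.
rewrite (bigD1 k)//= mulrC EFinM -fr -/c.
have fk0 x : (0 <= (f k x)%:E)%E by rewrite lee_fin.
transitivity (\int[nu]_(w in xi k @^-1` [set: R])
    ((fun x => (f k x)%:E) \o xi k) w)%E => //.
transitivity ((NngNum c0)%:num%:E * \int[P]_(w in xi k @^-1` [set: R])
    ((fun x => (f k x)%:E) \o xi k) w)%E => //.
rewrite -!(ge0_integral_pushforward (mxi k))// -ge0_integral_mscale//.
(* Both sides now integrate [f k] over the line, so it suffices that the two measures agree on every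
   [B]. *)
apply: eq_measure_integral => B mB _.
have mxB := measurable_xi_preimage k mB.
have PB := fin_num_measure P _ mxB.
rewrite /mscale /= /pushforward nuE//.
pose f' i := if i == k then \1_B else f i.
pose r' i := if i == k then fine (P (xi k @^-1` B)) else r i.
transitivity (\int[P]_w (\prod_i f' i (xi i w))%:E)%E.
  rewrite integral_mkcond; apply: eq_integral => w _.
  rewrite epatch_indic -EFinM (bigD1 k)//= /f' eqxx mulrC; congr (_ * _)%:E.
  by apply: eq_bigr => i /negbTE ->.
rewrite (IH f' r').
- rewrite (bigD1 k)//= /r' eqxx mulrC EFinM fineK//; congr (_%:E * _)%E.
  by apply: eq_bigr => i /negbTE ->.
- move=> i ins; rewrite /f'; case: eqVneq => [_|ik]; first by exists B.
  by apply: f_ind; rewrite inE negb_or ik.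
- by move=> i; rewrite /f'; case: eqP => // _; exact: measurable_indic.
- by move=> i x; rewrite /f'; case: eqP.
- move=> i; rewrite /f' /r'; case: eqP => // ->.
  by rewrite fineK// (_ : (fun w => _) = (fun w => (\1_(xi k @^-1` B) w)%:E))//
    integral_indic// setIT.
Qed.

Lemma integral_prod_independent (f : I -> R -> R) (r : I -> R) :
  (forall i, measurable_fun [set: R] (f i)) -> (forall i x, 0 <= f i x) ->
  (forall i, \int[P]_w (f i (xi i w))%:E = (r i)%:E)%E ->
  (\int[P]_w (\prod_i f i (xi i w))%:E = (\prod_i r i)%:E)%E.
Proof.
(* The list contains every index, so no factor has to be an indicator. *)
by apply: (integral_prod_seq (s := enum I)) => i; rewrite mem_enum.
Qed.

End integral_prod.

(** * Boxes determine finite measures on arrays *)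

Definition tuple_box (T : Type) (n m : nat) (B : 'I_n * 'I_m -> set T) :
    set (n.-tuple (m.-tuple T)) :=
  [set y | forall k, B k (tnth (tnth y k.1) k.2)].

Lemma measurable_tuple_box (d : measure_display) (T : measurableType d)
    (n m : nat) (B : 'I_n * 'I_m -> set T) :
  (forall k, measurable (B k)) -> measurable (tuple_box B).
Proof.
move=> mB.
have -> : tuple_box B = \bigcap_k ((fun y : n.-tuple (m.-tuple T) =>
    tnth (tnth y k.1) k.2) @^-1` B k).
  by apply/seteqP; split => y By k; [move=> _|]; exact: By.
apply: fin_bigcap_measurable => // k _.
rewrite -[X in measurable X]setTI.
have mk : measurable_fun [set: n.-tuple (m.-tuple T)]
    (fun y => tnth (tnth y k.1) k.2).
  by apply: (measurableT_comp (measurable_tnth (T := T) k.2)); exact: measurable_tnth.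
exact: mk.
Qed.

(** Boxes are stable under intersection and generate the sigma-algebra; since [mu] is finite, the
    constant sequence [setT] serves as the exhaustion. *)
Lemma tuple_measure_unique (R : realType) (d : measure_display)
    (T : measurableType d) (n m : nat)
    (mu nu : {measure set (n.-tuple (m.-tuple T)) -> \bar R}) :
  (mu setT < +oo)%E ->
  (forall B : 'I_n * 'I_m -> set T, (forall k, measurable (B k)) ->
     mu (tuple_box B) = nu (tuple_box B)) ->
  forall A, measurable A -> mu A = nu A.
Proof.
move=> muT munu.
pose G : set (set (n.-tuple (m.-tuple T))) :=
  [set A | exists B : 'I_n * 'I_m -> set T,
     (forall k, measurable (B k)) /\ A = tuple_box B].
apply: (measure_unique G (fun=> setT)) => //.
- apply/seteqP; split => [A mA|].
    (* The identity out of the space generated by boxes is measurable because its coordinates are: a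
       coordinate preimage is a box with a single constrained side. *)
    pose U := g_sigma_algebraType G.
    have idm : measurable_fun [set: U] (id : U -> n.-tuple (m.-tuple T)).
      apply/measurable_fun_tnthP => i; apply/measurable_fun_tnthP => j _ B mB.
      rewrite setTI; apply: sub_sigma_algebra.
      exists (fun k => if k == (i, j) then B else setT); split.
        by move=> k; case: eqP.
      apply/seteqP; split => y /=.
        by move=> By k; case: eqP => // ->.
      by move/(_ (i, j)); rewrite eqxx.
    by have := idm measurableT A mA; rewrite setTI.
  apply: smallest_sub; first exact: sigma_algebra_measurable.
  by move=> A [B [mB ->]]; exact: measurable_tuple_box.
- move=> _ _ [B [mB ->]] [C [mC ->]].
  exists (fun k => B k `&` C k); split=> [k|]; first exact: measurableI.
  apply/seteqP; split => y /=.
    by move=> [By Cy] k; split; [exact: By|exact: Cy].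
  by move=> BCy; split => k; have [] := BCy k.
- by move=> _; exists (fun=> setT); split => //; apply/seteqP; split.
- by apply/seteqP; split => // y _; exists 0%N.
- by move=> A [B [mB ->]]; exact: munu.
Qed.

Lemma exists_pushforward_measure (d1 d2 : measure_display)
    (T1 : measurableType d1) (T2 : measurableType d2) (R : realType)
    (m : {measure set T1 -> \bar R}) (f : T1 -> T2) :
  measurable_fun [set: T1] f ->
  exists mu : {measure set T2 -> \bar R}, forall A, mu A = m (f @^-1` A).
Proof.
move=> mf.
by exists (measure_function_pushforward__canonical__measure_function_Measure m mf).
Qed.

(** * Change of measure for the Gaussian noise vector *)

Lemma integral_indic_tilt (R : realType) (d : measure_display)
    (Omega : measurableType d) (P : probability Omega R) (xi : Omega -> R)
    (s2 c : R) (B : set R) :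
  0 < s2 -> measurable_fun [set: Omega] xi ->
  (forall C, measurable C -> P (xi @^-1` C) = normal_prob 0 (Num.sqrt s2) C) ->
  measurable B ->
  (\int[P]_w (\1_B (xi w) * gaussian_tilt s2 c (xi w))%:E =
   P ((fun w => (c + xi w)%R) @^-1` B))%E.
Proof.
move=> s20 mxi xiN mB.
have mc : measurable_fun [set: R] (+%R c : R -> R) by exact: measurable_funD.
have mcB : measurable ((+%R c : R -> R) @^-1` B).
  by rewrite -[X in measurable X]setTI; exact: mc.
transitivity (P (xi @^-1` ((+%R c : R -> R) @^-1` B))) => //.
rewrite xiN// normal_prob_shift//.
(* [normal_prob] is a measure on [measurableTypeR R], which has the same
   measurable sets as [R] but another display. *)
have mxi' : measurable_fun [set: Omega] (xi : Omega -> measurableTypeR R) by [].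
pose F (x : measurableTypeR R) := (\1_B x * gaussian_tilt s2 c x)%:E.
have mF : measurable_fun [set: measurableTypeR R] F.
  by apply/measurable_EFinP/measurable_funM => //; exact: measurable_gaussian_tilt.
transitivity (\int[P]_(w in xi @^-1` [set: measurableTypeR R]) (F \o xi) w)%E => //.
rewrite -(ge0_integral_pushforward mxi')//; last first.
  by move=> x _; rewrite lee_fin mulr_ge0 ?gaussian_tilt_ge0.
by apply: eq_measure_integral => C mC _; exact: xiN.
Qed.

Section gaussian_vector.
Context (R : realType) (d : measure_display) (Omega : measurableType d).
Variables (P : probability Omega R) (n m : nat).
Variables (xi : 'I_n * 'I_m -> Omega -> R) (s2 : R).
Hypothesis s2_gt0 : 0 < s2.
Hypothesis mxi : forall k, measurable_fun [set: Omega] (xi k).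
Hypothesis xiN : forall k B, measurable B ->
  P (xi k @^-1` B) = normal_prob 0 (Num.sqrt s2) B.
Hypothesis indep : mutually_independent P (fun k => sigma_real (xi k)).

(** For [c = fun=> 0] this is pure noise; for the signs of a tuple [t] it is the release on the
    event [X = t]. *)
Definition shifted_vector (c : 'I_n * 'I_m -> R) (w : Omega) :
    n.-tuple (m.-tuple R) :=
  [tuple [tuple c (i, j) + xi (i, j) w | j < m] | i < n].

(** The density of the law of [shifted_vector c] with respect to pure noise, evaluated at the
    noise. *)
Definition likelihood (c : 'I_n * 'I_m -> R) (w : Omega) : R :=
  \prod_k gaussian_tilt s2 (c k) (xi k w).

Lemma tnth_shifted_vector c w k :
  tnth (tnth (shifted_vector c w) k.1) k.2 = c k + xi k w.
Proof. by case: k => i j; rewrite !tnth_mktuple. Qed.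

Lemma measurable_shifted_vector c : measurable_fun [set: Omega] (shifted_vector c).
Proof.
apply/measurable_fun_tnthP => i; apply/measurable_fun_tnthP => j.
have -> : @tnth m R ^~ j \o (@tnth n (m.-tuple R) ^~ i \o shifted_vector c) =
    (fun w => c (i, j) + xi (i, j) w).
  by apply/funext => w /=; rewrite (tnth_shifted_vector c w (i, j)).
exact: measurable_funD.
Qed.

Lemma measurable_likelihood c : measurable_fun [set: Omega] (likelihood c).
Proof.
apply: measurable_prod => k _.
by apply: measurableT_comp => //; exact: measurable_gaussian_tilt.
Qed.

Lemma likelihood_ge0 c w : 0 <= likelihood c w.
Proof. by apply: prodr_ge0 => k _; exact: gaussian_tilt_ge0. Qed.

(** On a box, indicator times likelihood is a product over coordinates, so independence reduces the
    claim to the one-dimensional shift. *)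
Lemma integral_likelihood_box c (B : 'I_n * 'I_m -> set R) :
  (forall k, measurable (B k)) ->
  (\int[P]_(w in shifted_vector (fun=> 0%R) @^-1` tuple_box B) (likelihood c w)%:E =
   \prod_k P ((fun w => (c k + xi k w)%R) @^-1` B k))%E.
Proof.
move=> mB.
pose f k x := \1_(B k) x * gaussian_tilt s2 (c k) x.
have mcB k : measurable ((fun w => c k + xi k w) @^-1` B k).
  rewrite -[X in measurable X]setTI.
  have mck : measurable_fun [set: Omega] (fun w => c k + xi k w) by exact: measurable_funD.
  exact: mck.
have fE k : (\int[P]_w (f k (xi k w))%:E =
    (fine (P ((fun w => (c k + xi k w)%R) @^-1` B k)))%:E)%E.
  by rewrite integral_indic_tilt// ?fineK ?fin_num_measure//; exact: xiN.
rewrite (eq_bigr (fun k => (fine (P ((fun w => (c k + xi k w)%R) @^-1` B k)))%:E)); last first.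
  by move=> k _; rewrite fineK// fin_num_measure.
rewrite prodEFin -(integral_prod_independent (f := f) mxi indep _ _ fE).
- rewrite integral_mkcond; apply: eq_integral => w _.
  rewrite /f epatch_indic -EFinM; congr EFin.
  rewrite big_split/= mulrC; congr (_ * _).
  rewrite indicE; case: (asboolP (tuple_box B (shifted_vector (fun=> 0%R) w))) => Bw.
    rewrite mem_set// big1// => k _; rewrite indicE mem_set//.
    by have := Bw k; rewrite tnth_shifted_vector add0r.
  rewrite memNset//; have [k Bk] : exists k, ~ B k (xi k w).
    apply/existsNP => Bw'; apply: Bw => k.
    by rewrite tnth_shifted_vector add0r.
  by rewrite (bigD1 k)//= indicE memNset// mul0r.
- by move=> k; apply: measurable_funM => //; exact: measurable_gaussian_tilt.
- by move=> k x; rewrite mulr_ge0 ?gaussian_tilt_ge0.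
Qed.

Lemma integral_likelihood c : (\int[P]_w (likelihood c w)%:E = 1)%E.
Proof.
have := integral_likelihood_box c (fun=> measurableT).
rewrite big1 => [<-|k _]; last by rewrite preimage_setT probability_setT.
by rewrite (_ : tuple_box _ = setT)//; apply/seteqP; split.
Qed.

(** Together with [integral_likelihood] at [2 * c], this makes the second moment of the likelihood
    explicit. *)
Lemma likelihood_sqr c w :
  likelihood c w ^+ 2 =
  expR (\sum_k c k ^+ 2 / s2) * likelihood (fun k => 2 * c k) w.
Proof.
rewrite /likelihood -prodrXl expR_sum -big_split/=.
by apply: eq_bigr => k _; exact: gaussian_tilt_sqr.
Qed.

Variable E0 : set Omega.
Hypothesis mE0 : measurable E0.
Hypothesis indepE0 : forall A : 'I_n * 'I_m -> set Omega,
  (forall k, sigma_real (xi k) (A k)) ->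
  P (E0 `&` \bigcap_k A k) = (P E0 * \prod_k P (A k))%E.

(** Both sides are measures in [S]; they agree on boxes by [indepE0] and [integral_likelihood_box],
    hence everywhere. In the application [E0] is the event [X = t]. *)
Lemma shifted_vector_law c (S : set (n.-tuple (m.-tuple R))) : measurable S ->
  P (E0 `&` shifted_vector c @^-1` S) =
  (P E0 * \int[P]_(w in shifted_vector (fun=> 0%R) @^-1` S) (likelihood c w)%:E)%E.
Proof.
move=> mS.
have [nu [nuE _]] := ge0_density_measure P (measurable_likelihood c) (likelihood_ge0 c).
have [mu1 mu1E] := exists_pushforward_measure
  (mrestr P mE0) (measurable_shifted_vector c).
have p0 : 0 <= fine (P E0) by rewrite fine_ge0.
have [mu2 mu2E] := exists_pushforward_measure
  (mscale (NngNum p0) nu) (measurable_shifted_vector (fun=> 0%R)).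
have mY c' (A : set (n.-tuple (m.-tuple R))) : measurable A ->
    measurable (shifted_vector c' @^-1` A).
  by move=> mA; rewrite -[X in measurable X]setTI; exact: measurable_shifted_vector.
have mu2E' A : measurable A -> mu2 A = (P E0 *
    \int[P]_(w in shifted_vector (fun=> 0%R) @^-1` A) (likelihood c w)%:E)%E.
  by move=> mA; rewrite mu2E /= /mscale nuE ?fineK ?fin_num_measure//; exact: mY.
rewrite -mu2E'// setIC -[LHS](mu1E S).
apply: (tuple_measure_unique (m := m) (n := n)) => //.
  by rewrite mu1E preimage_setT /= /mrestr setTI ltey_eq fin_num_measure.
move=> B mB; rewrite mu2E'; last exact: measurable_tuple_box.
rewrite integral_likelihood_box// -indepE0; last first.
  move=> k; exists ((+%R (c k) : R -> R) @^-1` B k); split => //.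
  have mc : measurable_fun [set: R] (+%R (c k) : R -> R) by exact: measurable_funD.
  by rewrite -[X in measurable X]setTI; exact: mc.
rewrite mu1E /= /mrestr setIC; congr (P (_ `&` _)).
apply/seteqP; split => w Bw k.
  by move=> _; have := Bw k; rewrite tnth_shifted_vector.
by rewrite tnth_shifted_vector; exact: Bw.
Qed.

(** The quadratic term is integrated over the whole space, where its value is known; the constant
    term keeps the set [S], so that it can later be summed over disjoint decoding events. *)
Lemma shifted_vector_prob_le c (S : set (n.-tuple (m.-tuple R))) (K : R) :
  measurable S -> 0 < K ->
  (P (E0 `&` shifted_vector c @^-1` S) <=
   P E0 * ((expR (\sum_k c k ^+ 2 / s2) / (2 * K))%:E +
           (K / 2)%:E * P (shifted_vector (fun=> 0%R) @^-1` S)))%E.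
Proof.
move=> mS K0; rewrite shifted_vector_law// lee_wpmul2l//.
set D := shifted_vector (fun=> 0%R) @^-1` S.
have mD : measurable D.
  by rewrite -[X in measurable X]setTI; exact: measurable_shifted_vector.
set a := expR _ / _.
have a0 : 0 <= a by rewrite divr_ge0 ?expR_ge0// mulr_ge0// ltW.
(* By [likelihood_sqr], [a * L2] is the square of the likelihood over [2 * K], and [L2] has integral
   1. *)
pose L2 := likelihood (fun k => 2 * c k).
have mL2 : measurable_fun [set: Omega] L2 by exact: measurable_likelihood.
have mL2a : measurable_fun [set: Omega] (fun w => (a * L2 w)%:E).
  by apply/measurable_EFinP; exact: measurable_funM.
apply: (@le_trans _ _ (\int[P]_(w in D) ((a * L2 w)%:E + (K / 2)%:E))%E).
  apply: ge0_le_integral => //.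
  - by move=> w _; rewrite lee_fin likelihood_ge0.
  - by apply: measurable_funTS; apply/measurable_EFinP; exact: measurable_likelihood.
  - apply: measurable_funTS; apply: emeasurable_funD => //.
  - move=> w _; rewrite -EFinD lee_fin.
    have -> : a * L2 w = likelihood c w ^+ 2 / (2 * K).
      by rewrite likelihood_sqr /a /L2 mulrAC.
    (* AM-GM: [2 K L <= L^2 + K^2] *)
    rewrite -subr_ge0.
    have -> : likelihood c w ^+ 2 / (2 * K) + K / 2 - likelihood c w =
        (likelihood c w - K) ^+ 2 / (2 * K).
      have Kn : K != 0 by rewrite gt_eqF.
      by field.
    by rewrite divr_ge0 ?sqr_ge0// mulr_ge0// ltW.
rewrite ge0_integralD//; last 3 first.
- by move=> w _; rewrite lee_fin mulr_ge0// likelihood_ge0.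
- exact: measurable_funTS.
- by move=> w _; rewrite lee_fin divr_ge0// ltW.
rewrite integral_cst// leeD2r//.
apply: (@le_trans _ _ (\int[P]_w (a * L2 w)%:E)%E).
  apply: ge0_subset_integral => // w _.
  by rewrite lee_fin mulr_ge0// likelihood_ge0.
under eq_integral do rewrite EFinM.
rewrite ge0_integralZl//; last 2 first.
- exact/measurable_EFinP.
- by move=> w _; rewrite lee_fin likelihood_ge0.
by rewrite integral_likelihood mule1.
Qed.

End gaussian_vector.

(** * Counting orderings and summing over decoded sets *)

Lemma ffact_expn_le (a b k : nat) : (a <= b -> a ^_ k * b ^ k <= b ^_ k * a ^ k)%N.
Proof.
move=> ab; elim: k => [//|k IH].
(* Compare factor by factor: [(a - k) * b <= (b - k) * a]. *)
rewrite !ffactnSr !expnSr mulnACA [leqRHS]mulnACA leq_mul//.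
by rewrite !mulnBl [(b * a)%N]mulnC leq_sub2l// leq_mul2l ab orbT.
Qed.

Lemma sum_probability_fibers (R : realType) (d : measure_display)
    (Omega : measurableType d) (P : probability Omega R) (T : finType)
    (F : Omega -> T) (E : set Omega) :
  (forall t, measurable (F @^-1` [set t])) -> measurable E ->
  P E = (\sum_t P (E `&` F @^-1` [set t]))%E.
Proof.
move=> mF mE.
rewrite [LHS](_ : _ = P (\bigcup_(t in [set: T]) (E `&` F @^-1` [set t]))).
  rewrite measure_fin_bigcup//.
  - rewrite (@fsbigE _ _ _ _ _ (index_enum T))//.
    + by apply: eq_bigl => t; rewrite in_setT.
    + exact: index_enum_uniq.
    + by move=> t _; rewrite mem_index_enum.
  - exact: finite_finset.
  - by move=> i j _ _ [w [[_ <-] [_ <-]]].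
  - by move=> t _; exact: measurableI.
congr (P _); apply/seteqP; split => [w Ew|w [t _ []]//].
by exists (F w).
Qed.

(** Group the tuples by underlying set: the fibre probabilities of [F] sum to 1, and each is counted
    at most [n!] times. *)
Lemma sum_probability_uniq_tuples (R : realType) (d : measure_display)
    (Omega : measurableType d) (P : probability Omega R) (T : finType) (n : nat)
    (F : Omega -> {set T}) :
  (forall w, #|F w| = n) -> (forall S, measurable (F @^-1` [set S])) ->
  (\sum_(t : n.-tuple T | uniq t) P (F @^-1` [set [set x in t]%SET]) <= (n`!)%:R%:E)%E.
Proof.
move=> cardF mF.
have PS0 (S : {set T}) : #|S| != n -> P (F @^-1` [set S]) = 0%E.
  move=> Sn; rewrite (_ : _ @^-1` _ = set0) ?measure0// -subset0 => w /= Fw.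
  by move: Sn; rewrite -Fw cardF eqxx.
pose q S := fine (P (F @^-1` [set S])).
have qE S : P (F @^-1` [set S]) = (q S)%:E by rewrite fineK// fin_num_measure.
have q0 S : 0 <= q S by rewrite fine_ge0.
have sumq : \sum_S q S = 1.
  apply: EFin_inj; rewrite -sumEFin -(probability_setT P).
  rewrite (sum_probability_fibers P mF measurableT).
  by apply: eq_bigr => S _; rewrite setTI qE.
under eq_bigr do rewrite qE.
rewrite sumEFin lee_fin.
rewrite (partition_big (fun t : n.-tuple T => [set x in t]%SET) xpredT)//=.
have -> : n`!%:R = \sum_S n`!%:R * q S by rewrite -mulr_sumr sumq mulr1.
apply: ler_sum => S _.
rewrite (eq_bigr (fun=> q S)); last by move=> t /andP[_ /eqP ->].
rewrite sumr_const -[leLHS]mulr_natl.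
have [Sn|Sn] := eqVneq #|S| n; last by rewrite /q PS0// !mulr0.
(* In this form [n!] counts the duplicate-free [n]-tuples with entries in [S]. *)
have -> : n`! = (#|S| ^_ n)%N by rewrite Sn ffactnn.
rewrite ler_wpM2r// ler_nat -card_uniq_tuples.
apply/subset_leq_card/fintype.subsetP => t; rewrite !inE => /andP[-> /eqP tS].
rewrite andbT; apply/allP => x xt.
by have : x \in S by rewrite -tS inE.
Qed.

(** * Numerical estimates *)

Lemma le_powR2 (R : realType) (y : R) : y <= 2 `^ y.
Proof.
(* Apply [ln (1 + x) <= x] at [x = - 1 / 2]. *)
have ln2 : 1 / 2 <= ln (2 : R).
  have := @le_ln1Dx R (- (1 / 2)); rewrite (_ : 1 + - (1 / 2) = 2^-1); last by field.
  rewrite lnV ?posrE//; lra.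
have e2 : 2 <= expR 1 :> R by have := expR_ge1Dx (1 : R); lra.
have [y0|y0] := ltP y 0; first by rewrite (le_trans (ltW y0))// powR_ge0.
rewrite /powR pnatr_eq0/=.
(* [expR x = expR 1 * expR (x - 1) >= expR 1 * x] at [x = y * ln 2] *)
have := expR_ge1Dx (y * ln 2 - 1).
rewrite addrCA subrr addr0 expRD expRN => h.
have e_le : expR 1 * (y * ln 2) <= expR (y * ln 2).
  by rewrite -ler_pdivlMl ?expR_gt0// [leRHS]mulrC.
apply: le_trans e_le.
have y2 : y / 2 <= y * ln 2 by rewrite ler_wpM2l// -[leLHS]mul1r.
have := ler_pM (ler0n _ 2) (divr_ge0 y0 (ler0n _ 2)) e2 y2.
by rewrite [X in X <= _]mulrC divfK.
Qed.

(** Ensures that [(2 ^ m) ^_ n] is nonzero, that is, that duplicate-free tuples exist. *)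
Lemma leq_exp2 (R : realType) (m n : nat) :
  n%:R <= (2 : R) `^ (m%:R / 4) -> (n <= 2 ^ m)%N.
Proof.
move=> nm; rewrite -(ler_nat R) natrX -powR_mulrn// (le_trans nm)// ler_powR ?ler1n//.
by rewrite ler_pdivrMr// ler_peMr// ler1n.
Qed.

(* With [u = 2 `^ (m / 4)] and [b = u ^+ n], one has [expR (n m / s2) <= b] and
   [n`! b ^+ 3 <= N], so the choice [K = b ^+ 2] balances the two terms of the
   second-moment bound at [b^-1 / 2] each. *)
Lemma second_moment_bound (R : realType) (m n : nat) (s2 gamma : R) :
  (0 < m)%N -> (0 < n)%N -> 0 < s2 -> 0 < gamma < 1 ->
  gamma <= 1 - 4 / (n%:R * m%:R) ->
  n%:R <= (2 : R) `^ (m%:R / 4) ->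
  s2 >= 4 / ((1 - gamma) * ln (2 : R)) ->
  exists2 K : R, 0 < K &
    expR ((n * m)%:R / s2) / (2 * K) + K / 2 * (n`!%:R / ((2 ^ m) ^_ n)%:R) <=
    1 - gamma.
Proof.
move=> m0 n0 s20 /andP[g0 g1] g4 nu s2ge.
set u := 2 `^ (m%:R / 4) in nu; pose b := u ^+ n.
have u0 : 0 < u by rewrite powR_gt0.
have b0 : 0 < b by rewrite exprn_gt0.
have bE : b = 2 `^ ((n * m)%:R / 4).
  by rewrite /b -powR_mulrn ?ltW// -powRrM natrM; congr (_ `^ _); ring.
have nm0 : 0 < (n * m)%:R :> R by rewrite ltr0n muln_gt0 n0.
have ln20 : 0 < ln (2 : R) by rewrite ln_gt0// ltr1n.
have b_nm : (n * m)%:R / 4 <= b by rewrite bE le_powR2.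
have b_gamma : b^-1 <= 1 - gamma.
  have : b^-1 <= 4 / (n%:R * m%:R).
    by rewrite -natrM -[leRHS]invf_div lef_pV2 ?posrE ?divr_gt0.
  lra.
(* The noise bound gives [s2^-1 <= (1 - gamma) * ln 2 / 4 <= ln 2 / 4]. *)
have exp_b : expR ((n * m)%:R / s2) <= b.
  rewrite bE /powR pnatr_eq0/= ler_expR -[leRHS]mulrA ler_pM2l//.
  have s2V : s2^-1 <= (1 - gamma) * ln 2 / 4.
    rewrite -[leRHS]invf_div lef_pV2 ?posrE ?divr_gt0 ?mulr_gt0 ?subr_gt0//.
  apply: le_trans s2V _; rewrite [leRHS]mulrC ler_wpM2r//.
  by apply: ler_piMl; [exact: ltW | rewrite lerBlDr lerDl ltW].
have u4 : (2 ^ m)%:R = u ^+ 4 :> R.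
  by rewrite natrX -!powR_mulrn ?ltW// -powRrM; congr (_ `^ _); field.
have n_le := leq_exp2 nu.
have N0 : 0 < ((2 ^ m) ^_ n)%:R :> R by rewrite ltr0n ffact_gt0.
(* The ratio is at most [n ^ n / (2 ^ m) ^ n], where [n ^ n <= u ^+ n = b] and
   [(2 ^ m) ^ n = b ^+ 4]. *)
have fact_b : n`!%:R / ((2 ^ m) ^_ n)%:R <= (b ^+ 3)^-1.
  rewrite ler_pdivrMr// ler_pdivlMl ?exprn_gt0//.
  have := ffact_expn_le n n_le; rewrite ffactnn -(ler_nat R) !natrM.
  rewrite (natrX _ (2 ^ m)%N n) (natrX _ n n) u4 => h.
  have bb : (u ^+ 4) ^+ n = b * b ^+ 3 by rewrite -exprS -!exprM mulnC.
  have nb : n%:R ^+ n <= b by rewrite lerXn2r ?nnegrE// ltW.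
  rewrite -(ler_pM2l b0) mulrA -bb mulrC (le_trans h)// [leRHS]mulrC ler_wpM2l//.
exists (b ^+ 2); first by rewrite exprn_gt0.
apply: le_trans b_gamma.
have -> : b^-1 = b / (2 * b ^+ 2) + b ^+ 2 / 2 * (b ^+ 3)^-1.
  have bn : b != 0 by rewrite gt_eqF.
  by field.
rewrite lerD//.
  by rewrite ler_wpM2r// invr_ge0 mulr_ge0// exprn_ge0// ltW.
by rewrite ler_wpM2l// divr_ge0// exprn_ge0// ltW.
Qed.

(** * Averaging over the data *)

Theorem theorem4 (R : realType) (dOm : measure_display) (Omega : measurableType dOm)
  (P : probability Omega R) (dim n : nat)
  (X : Omega -> n.-tuple (dim.-tuple bool))
  (eta : 'I_n -> 'I_dim -> Omega -> R)
  (s2 gamma : R) :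
  (0 < dim)%N -> (1 <= n)%N ->
  (* X is a uniformly random n-subset of {-1,1}^dim listed in uniformly random
     order, i.e. uniform over the duplicate-free n-tuples *)
  (forall t, measurable [set w | X w = t]) ->
  (forall t : n.-tuple (dim.-tuple bool), uniq t ->
     P [set w | X w = t] =
       ((#|[pred u : n.-tuple (dim.-tuple bool) | uniq u]|)%:R^-1)%:E) ->
  (* the noise coordinates are N(0, s2), mutually independent and independent of X *)
  0 < s2 ->
  (forall i j, measurable_fun [set: Omega] (eta i j)) ->
  (forall i j (B : set R), measurable B ->
     P (eta i j @^-1` B) = normal_prob 0 (Num.sqrt s2) B) ->
  mutually_independent P
    (fun k : option ('I_n * 'I_dim) =>
       match k with
       | None => sigma_fin X
       | Some ij => sigma_real (eta ij.1 ij.2)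
       end) ->
  0 < gamma < 1 ->
  gamma <= 1 - 4 / (n%:R * dim%:R) ->
  n%:R <= (2 : R) `^ (dim%:R / 4) ->
  s2 >= 4 / ((1 - gamma) * ln (2 : R)) ->
  forall A : n.-tuple (dim.-tuple R) -> {set dim.-tuple bool},
    (forall y, #|A y| = n) ->
    (forall S, measurable (A @^-1` [set S])) ->
    (gamma%:E <= P [set w | A (noisy_release X eta w) != [set x in X w]])%E.
Proof.
move=> m0 n0 mX PX s20 meta etaN indep g01 g4 nu s2ge A cardA mA.
pose xi (k : 'I_n * 'I_dim) := eta k.1 k.2.
have mxi k : measurable_fun [set: Omega] (xi k) by exact: meta.
have xiN k B : measurable B -> P (xi k @^-1` B) = normal_prob 0 (Num.sqrt s2) B.
  exact: etaN.
have indep_xi : mutually_independent P (fun k => sigma_real (xi k)).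
  exact: (mutually_independent_Some indep).
pose c (t : n.-tuple (dim.-tuple bool)) (k : 'I_n * 'I_dim) : R :=
  pm1 (tnth (tnth t k.1) k.2).
have sum_c t : \sum_k c t k ^+ 2 / s2 = (n * dim)%:R / s2.
  rewrite -mulr_suml; congr (_ / _).
  rewrite (eq_bigr (fun=> 1)) => [|k _]; last first.
    by rewrite /c /pm1; case: ifP; rewrite ?sqrrN expr1n.
  by rewrite sumr_const card_prod !card_ord.
(* The reference vector is the same for all [t], so all the events [Y0 @^-1 S t] concern the single
   random set [A (Y0 w)]. *)
pose Y0 : Omega -> n.-tuple (dim.-tuple R) := shifted_vector xi (fun=> 0).
pose S (t : n.-tuple (dim.-tuple bool)) : set (n.-tuple (dim.-tuple R)) :=
  A @^-1` [set [set x in t]%SET].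
pose N : R := ((2 ^ dim) ^_ n)%:R.
have N0 : 0 < N by rewrite ltr0n ffact_gt0 (leq_exp2 nu).
have cardN : #|[pred u : n.-tuple (dim.-tuple bool) | uniq u]| = ((2 ^ dim) ^_ n)%N.
  have -> : (2 ^ dim = #|[pred x : dim.-tuple bool | true]|)%N.
    by rewrite -card_bool -card_tuple; apply: eq_card.
  rewrite -card_uniq_tuples; apply: eq_card => u; rewrite !inE.
  by rewrite (_ : all _ _ = true)//; apply/allP.
have PXN (t : n.-tuple (dim.-tuple bool)) : uniq t -> P [set w | X w = t] = N^-1%:E.
  by move=> ut; rewrite PX// cardN.
have [K K0 HK] := second_moment_bound m0 n0 s20 g01 g4 nu s2ge.
set a := expR _ / _ in HK.
pose q t := P (Y0 @^-1` S t).
have mS t : measurable (S t) by exact: mA.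
have mY c' (B : set (n.-tuple (dim.-tuple R))) : measurable B ->
    measurable (shifted_vector xi c' @^-1` B).
  by move=> mB; rewrite -[X in measurable X]setTI; exact: measurable_shifted_vector.
have success (t : n.-tuple (dim.-tuple bool)) : uniq t ->
    (P ([set w | X w = t] `&` shifted_vector xi (c t) @^-1` S t) <=
     N^-1%:E * (a%:E + (K / 2)%:E * q t))%E.
  move=> ut; rewrite -(PXN _ ut) /a -(sum_c t).
  apply: shifted_vector_prob_le => // B sB.
  by apply: (mutually_independent_None indep) => //; exists [set t].
have releaseE w : noisy_release X eta w = shifted_vector xi (c (X w)) w by [].
pose F := [set w | A (noisy_release X eta w) != [set x in X w]%SET].
(* On [X = t], failure is the complement of decoding the set of [t], so the success bound turns into
   a lower bound on failure. *)
have FE t : F `&` X @^-1` [set t] =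
    X @^-1` [set t] `\` shifted_vector xi (c t) @^-1` S t.
  apply/seteqP; split => w /=.
    move=> [Fw Xw]; split => // Sw; move: Fw.
    by rewrite /F/= releaseE Xw Sw eqxx.
  move=> [Xw NSw]; split => //; rewrite /F/= releaseE Xw.
  exact/eqP.
have mFt t : measurable (F `&` X @^-1` [set t]).
  by rewrite FE; apply: measurableD; [exact: mX|exact: mY].
have mF : measurable F.
  have -> : F = \bigcup_(t in [set: n.-tuple (dim.-tuple bool)]) (F `&` X @^-1` [set t]).
    by apply/seteqP; split => [w Fw|w [t _ []]//]; exists (X w).
  by apply: fin_bigcup_measurable => //; exact: finite_finset.
have q_fin t : q t = (fine (q t))%:E by rewrite fineK// fin_num_measure//; exact: mY.
have sumq : \sum_(t : n.-tuple (dim.-tuple bool) | uniq t) fine (q t) <= n`!%:R.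
  rewrite -lee_fin -sumEFin.
  under eq_bigr do rewrite -q_fin.
  apply: (@sum_probability_uniq_tuples _ _ _ P _ n (A \o Y0)) => [w|T].
    exact: cardA.
  exact: (mY _ _ (mA T)).
have failure (t : n.-tuple (dim.-tuple bool)) : uniq t ->
    ((N^-1 - N^-1 * (a + K / 2 * fine (q t)))%:E <= P (F `&` X @^-1` [set t]))%E.
  move=> ut; rewrite FE measureD//=; [|exact: mX|exact: mY|].
    rewrite EFinB leeB//.
      by rewrite -(PXN t ut).
    by have := success t ut; rewrite (q_fin t).
  by rewrite (PXN t ut) ltry.
rewrite (sum_probability_fibers P mX mF).
apply: (@le_trans _ _ (\sum_(t : n.-tuple (dim.-tuple bool) | uniq t)
    P (F `&` X @^-1` [set t]))%E); last first.
  rewrite [leRHS](bigID (fun t : n.-tuple (dim.-tuple bool) => uniq t))/= leeDl//.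
  by apply: sume_ge0.
apply: le_trans (lee_sum _ failure).
clearbody a.
(* The [N] equal weights [N^-1] cancel, leaving 1 minus [a] minus [K / 2] times the sum of the [q t]
   over [N]; [sumq] and [HK] conclude. *)
rewrite sumEFin lee_fin sumrB -mulr_sumr big_split/= -mulr_sumr !sumr_const.
rewrite -[X in _ *+ X]/(#|[pred u : n.-tuple (dim.-tuple bool) | uniq u]|) cardN.
rewrite -(mulr_natr N^-1) -(mulr_natr a) -/N mulVf ?gt_eqF// mulrDr.
rewrite mulrCA mulVf ?gt_eqF// mulr1.
rewrite lerBrDl -lerBrDr (le_trans _ HK)// lerD2l mulrCA ler_pM2l ?divr_gt0//.
by rewrite mulrC ler_pM2r ?invr_gt0.
Qed.
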